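(* Let $\sim$ be a prelambda congruence and let $A$ be a term. Then $\mathrm{Ind}_\sim(A) = \{ v \in \mathbb{V} : v \in \mathrm{NF}(B) \text{ for some term } B \text{ such that } B \sim A\}$.
   Context: Let $\mathbb{V}$ be an infinite set whose elements are called variables. The set $\mathbb{T}$ of terms is the set of words inductively defined by: every variable $x$ is a term; if $A,B$ are terms then $[AB]$ is a term; if $x$ is a variable and $A$ a term then $[\lambda x A]$ is a term. Equality of terms is syntactic identity. We abbreviate $[AB]$ as $AB$ and $[\lambda x A]$ as $\lambda x A$. A binary relation $\sim$ on $\mathbb{T}$ is a congruence if it is reflexive, symmetric, transitive, and for all terms $A,B,C,D$ and every variable $x$: $A\sim B$ implies $\lambda x A \sim \lambda x B$, and $A\sim B$, $C \sim D$ imply $AC \sim BD$. A prelambda congruence is a congruence $\sim$ such that for all terms $A,B,D$ and all variables $x,y$: ($\beta_1$) $[\lambda x x]D \sim D$; ($\beta_2$) $[\lambda x y]D \sim y$ whenever $x\neq y$; ($\beta_3$) $[\lambda x[AB]]D \sim [[\lambda x A]D][[\lambda x B]D]$; ($\beta_4$) $[\lambda x[\lambda x A]]D \sim \lambda x A$; ($\beta_5$) if $x \neq y$ and $[\lambda y D]x \sim D$, then $[\lambda x[\lambda y A]]D \sim \lambda y[[\lambda x A]D]$. For a prelambda congruence $\sim$ and a term $A$, $\mathrm{Ind}_\sim(A) = \{x \in \mathbb{V} : [\lambda x A]z \sim A \text{ for some variable } z \text{ with } x \neq z\}$. The set $\mathrm{NF}(A)$ of variables not occurring free in $A$ is defined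 by induction: $\mathrm{NF}(x) = \mathbb{V}\setminus\{x\}$, $\mathrm{NF}(BC) = \mathrm{NF}(B)\cap \mathrm{NF}(C)$, $\mathrm{NF}(\lambda x B) = \mathrm{NF}(B) \cup \{x\}$. *)

(* Defs.v *)
From mathcomp Require Import all_boot.
From mathcomp Require Import boolp classical_sets functions cardinality.

Set Implicit Arguments.
Unset Strict Implicit.
Unset Printing Implicit Defensive.

Local Open Scope classical_set_scope.

(* Raw terms: equality is syntactic identity, with no quotient by renaming of
   bound variables. The bracketed words of the informal definition are uniquely
   readable, hence are the same thing as elements of this inductive type. *)
Inductive term (V : Type) : Type :=
| Var of V
| App of term V & term V
| Lam of V & term V.

Record congruence (V : Type) (R : term V -> term V -> Prop) : Prop := {
  congr_refl : forall A, R A A;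
  congr_sym : forall A B, R A B -> R B A;
  congr_trans : forall A B C, R A B -> R B C -> R A C;
  congr_lam : forall x A B, R A B -> R (Lam x A) (Lam x B);
  congr_app : forall A B C D, R A B -> R C D -> R (App A C) (App B D)
}.

Record prelambda_congruence (V : Type) (R : term V -> term V -> Prop) : Prop := {
  prelambda_congr : congruence R;
  beta1 : forall x D, R (App (Lam x (Var x)) D) D;
  beta2 : forall x y D, x <> y -> R (App (Lam x (Var y)) D) (Var y);
  beta3 : forall x A B D,
    R (App (Lam x (App A B)) D) (App (App (Lam x A) D) (App (Lam x B) D));
  beta4 : forall x A D, R (App (Lam x (Lam x A)) D) (Lam x A);
  beta5 : forall x y A D, x <> y -> R (App (Lam y D) (Var x)) D ->
    R (App (Lam x (Lam y A)) D) (Lam y (App (Lam x A) D))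
}.

Definition Ind (V : Type) (R : term V -> term V -> Prop) (A : term V) : set V :=
  [set x | exists z, x <> z /\ R (App (Lam x A) (Var z)) A].

Fixpoint NF (V : Type) (A : term V) : set V :=
  match A with
  | Var x => ~` [set x]
  | App B C => NF B `&` NF C
  | Lam x B => NF B `|` [set x]
  end.

(* Main.v *)
Require Import Defs.
From mathcomp Require Import all_boot.
From mathcomp Require Import boolp classical_sets functions cardinality.

Local Open Scope classical_set_scope.

(** The term [[λx A]z] with [z <> x] does not contain [x] free, which gives one
    inclusion at once. Conversely, if [x] is not free in [B], then [[λx B]z ~ B]
    as soon as [z] avoids the binders of [B]; such a [z] exists since there are
    infinitely many variables. *)

Fixpoint binders (V : Type) (A : term V) : set V :=
  match A with
  | Var _ => set0
  | App B C => binders V B `|` binders V C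
  | Lam x B => x |` binders V B
  end.

Lemma finite_binders (V : Type) (A : term V) : finite_set (binders V A).
Proof.
elim: A => [x|B finB C finC|x B finB] /=; first exact: finite_set0.
- by rewrite finite_setU.
- by rewrite finite_setU; split => //; exact: finite_set1.
Qed.

Lemma infinite_setT_fresh (V : Type) (F : set V) :
  infinite_set [set: V] -> finite_set F -> exists z, ~ F z.
Proof.
move=> infV finF; apply: contra_notP infV => /forallNP noz.
by apply: sub_finite_set finF => z _; exact: contrapT (noz z).
Qed.

(** Induction on [B], one axiom per shape: [beta2] at a variable, [beta3] at an application, [beta4]
    or [beta5] at an abstraction according to whether it binds [x]. *)
Lemma prelambda_subst_NF (V : Type) (R : term V -> term V -> Prop)
    (B : term V) (x z : V) :
  prelambda_congruence R -> NF B x -> ~ binders V B z ->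
  R (App (Lam x B) (Var z)) B.
Proof.
move=> pR; have cR := prelambda_congr pR.
elim: B => [y|B IHB C IHC|y B IHB] /=.
- by move=> yx _; apply: (beta2 pR) => xy; exact: yx.
- move=> [xB xC] /not_orP[zB zC].
  apply: (congr_trans cR) (beta3 pR x B C (Var z)) _.
  by apply: (congr_app cR); [exact: IHB|exact: IHC].
- move=> xNF /not_orP[zy zB].
  have [->|xy] := pselect (x = y); first exact: (beta4 pR).
  have xB : NF B x by case: xNF.
  (* Side condition of [beta5] with [D] the variable [z]: it holds because [z] is not the binder
     [y]. *)
  have yzx : R (App (Lam y (Var z)) (Var x)) (Var z).
    by apply: (beta2 pR) => yz; exact: zy.
  apply: (congr_trans cR) (beta5 pR B xy yzx) _.
  by apply: (congr_lam cR); exact: IHB.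
Qed.

Theorem theorem4p8 (V : Type) (V_infinite : infinite_set [set: V])
  (R : term V -> term V -> Prop) (R_prelambda : prelambda_congruence R)
  (A : term V) :
  Ind R A = [set v | exists B, R B A /\ NF B v].
Proof.
have cR := prelambda_congr R_prelambda.
apply/seteqP; split => x /=.
  move=> [z [xz RA]]; exists (App (Lam x A) (Var z)); split => //.
  by split; [right|exact: xz].
move=> [B [RBA xB]].
(* [Ind] asks for [z] distinct from [x], the substitution lemma for [z] outside the binders of
   [B]. *)
have [|z /not_orP[zx zB]] :=
  infinite_setT_fresh V ([set x] `|` binders V B) V_infinite.
  by rewrite finite_setU; split; [exact: finite_set1|exact: finite_binders].
exists z; split; first by move=> xz; exact: zx.
(* The chain is [[λx A]z ~ [λx B]z ~ B ~ A], passing through [B] to use [x] in [NF B]. *)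
apply: (congr_trans cR) (RBA).
apply: (congr_trans cR) (prelambda_subst_NF V R B x z R_prelambda xB zB).
apply: (congr_app cR) (congr_refl cR _).
by apply: (congr_lam cR); exact: (congr_sym cR) RBA.
Qed.
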